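(* Let $L/K$ be a finite Galois extension of number fields such that $G=\mathrm{Gal}(L/K)$ does not contain a subgroup of index $2$. Then for any Abelian variety $A$ over $K$, either $\operatorname{rk} A(L)=\operatorname{rk} A(K)$ or $\operatorname{rk} A(L)\ge\operatorname{rk} A(K)+2$.
   Context: $\operatorname{rk} A(F)$ denotes the Mordell–Weil rank of $A$ over the field $F$. *)

(* Defs.v *)
From HB Require Import structures.
From Stdlib Require Import ClassicalEpsilon.
From mathcomp Require Import all_boot all_order all_algebra all_fingroup all_field.
From mathcomp Require Import mpoly.

Set Implicit Arguments.
Unset Strict Implicit.
Unset Printing Implicit Defensive.

Import GRing.Theory.
Local Open Scope ring_scope.

(** * Projective space and its Zariski-closed subsets *)

(* P^n(F) as the set of lines through the origin in F^(n+1). *)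
Definition proj (F : fieldType) (n : nat) : Type :=
  {l : {vspace 'rV[F]_n.+1} | \dim l == 1%N}.

(* Homogeneous coordinates: some nonzero vector on the line.  Everything below
   only evaluates homogeneous polynomials at it, so the choice is immaterial. *)
Definition hcoord (F : fieldType) n (P : proj F n) : 'rV[F]_n.+1 :=
  vpick (val P).

Definition zeros (F : fieldType) n (s : seq {mpoly F[n.+1]}) : pred (proj F n) :=
  fun P => all (fun p => p.@[hcoord P 0] == 0) s.

(* Irreducibility for the Zariski topology: [X] is nonempty, and is not the
   union of two proper closed subsets. *)
Definition irreducible (F : fieldType) n (X : pred (proj F n)) : Prop :=
  (exists P, X P) /\
  forall s t : seq {mpoly F[n.+1]},
    {in s, forall p, p \is homog mdeg} -> {in t, forall p, p \is homog mdeg} ->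
    (forall P, X P -> zeros s P || zeros t P) ->
    (forall P, X P -> zeros s P) \/ (forall P, X P -> zeros t P).

(* [P] is rational over [F], embedded in [Omega] by [j]: it has homogeneous
   coordinates in [F]. *)
Definition rational (F Omega : fieldType) (j : {rmorphism F -> Omega}) n
    (P : proj Omega n) : Prop :=
  exists2 v : 'rV[F]_n.+1, v != 0 & val P = <[map_mx j v]>%VS.

(* Polynomials in the n+1 coordinates of P^n and the m+1 coordinates of P^m that
   are homogeneous of degree [d] in the former and [e] in the latter. *)
Definition bihomogeneous (R : nzRingType) n m (d e : nat)
    (p : {mpoly R[n.+1 + m.+1]}) : Prop :=
  {in msupp p, forall a : 'X_{1..n.+1 + m.+1},
    (\sum_(i < n.+1) a (lshift m.+1 i) = d)%N /\
    (\sum_(i < m.+1) a (rshift n.+1 i) = e)%N}.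

Section Varieties.

Variables (K Omega : fieldType) (iota : {rmorphism K -> Omega}).

Definition locus n (eqs : seq {mpoly K[n.+1]}) : pred (proj Omega n) :=
  zeros (map (map_mpoly iota) eqs).

(* The Omega-points of the subset of P^n cut out by [eqs]. *)
Definition points n (eqs : seq {mpoly K[n.+1]}) : Type :=
  {P : proj Omega n | locus eqs P}.

Definition coord n (eqs : seq {mpoly K[n.+1]}) (P : points eqs) :
  'rV[Omega]_n.+1 := hcoord (val P).

Definition evalv n m (f : 'I_m.+1 -> {mpoly K[n]}) (x : 'rV[Omega]_n) :
  'rV[Omega]_m.+1 := \row_i (map_mpoly iota (f i)).@[x 0].

(* Morphisms defined over [K]: around every point of the source, the map is given
   by a tuple of forms of the same degree with coefficients in [K], on the open
   set (containing the point) where these forms do not all vanish. *)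
Definition morphism1 n (eqs : seq {mpoly K[n.+1]})
    (f : points eqs -> points eqs) : Prop :=
  forall P : points eqs, exists (d : nat) (F : 'I_n.+1 -> {mpoly K[n.+1]}),
    [/\ forall i, F i \is d.-homog,
        evalv F (coord P) != 0
      & forall Q : points eqs, evalv F (coord Q) != 0 ->
          val (val (f Q)) = <[evalv F (coord Q)]>%VS].

(* Same for X x X -> X, with bihomogeneous forms on P^n x P^n. *)
Definition morphism2 n (eqs : seq {mpoly K[n.+1]})
    (f : points eqs -> points eqs -> points eqs) : Prop :=
  forall P P' : points eqs, exists (d e : nat) (F : 'I_n.+1 -> {mpoly K[n.+1 + n.+1]}),
    [/\ forall i, bihomogeneous d e (F i),
        evalv F (row_mx (coord P) (coord P')) != 0
      & forall Q Q' : points eqs, evalv F (row_mx (coord Q) (coord Q')) != 0 ->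
          val (val (f Q Q')) = <[evalv F (row_mx (coord Q) (coord Q'))]>%VS].

(* To be used only with [K] of characteristic 0 and [Omega] algebraically closed:
   an abelian variety over [K] is then a geometrically irreducible projective
   variety over [K], given by its [Omega]-points, with a group law defined over
   [K].  Smoothness is automatic ([K] is perfect and varieties are reduced), and
   the commutativity axiom is redundant by the rigidity lemma. *)
Record abelian_variety := AbelianVariety {
  av_ambient : nat;
  av_eqs : seq {mpoly K[av_ambient.+1]};
  av_homog : {in av_eqs, forall p, p \is homog mdeg};
  av_irr : irreducible (locus av_eqs);
  av_zero : points av_eqs;
  av_opp : points av_eqs -> points av_eqs;
  av_add : points av_eqs -> points av_eqs -> points av_eqs;
  av_zero_rational : rational iota (val av_zero);
  av_opp_morphism : morphism1 av_opp;
  av_add_morphism : morphism2 av_add;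
  av_addA : associative av_add;
  av_addC : commutative av_add;
  av_add0 : left_id av_zero av_add;
  av_addN : left_inverse av_zero av_opp av_add
}.

Definition av_points (A : abelian_variety) : Type := points (av_eqs A).

HB.instance Definition _ (A : abelian_variety) := Choice.on (av_points A).
HB.instance Definition _ (A : abelian_variety) :=
  GRing.isZmodule.Build (av_points A)
    (@av_addA A) (@av_addC A) (@av_add0 A) (@av_addN A).

End Varieties.

(** * Ranks *)

Definition Zindependent (U : zmodType) r (P : 'I_r -> U) : Prop :=
  forall c : 'I_r -> int, \sum_(i < r) P i *~ c i = 0 -> forall i, c i = 0.

(* [r] is the maximal number of Z-linearly independent elements of [S]. *)
Definition is_rank (U : zmodType) (S : U -> Prop) (r : nat) : Prop :=
  (exists P : 'I_r -> U, (forall i, S (P i)) /\ Zindependent P) /\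
  forall P : 'I_r.+1 -> U, (forall i, S (P i)) -> ~ Zindependent P.

(* Ranks are extended natural numbers, [None] being infinity. *)
Definition rank (U : zmodType) (S : U -> Prop) : option nat :=
  match excluded_middle_informative (exists r, is_rank S r) with
  | left h => Some (sval (constructive_indefinite_description _ h))
  | right _ => None
  end.

Definition enat_add (x : option nat) (n : nat) : option nat :=
  omap (fun m => (m + n)%N) x.

Definition enat_le (x y : option nat) : bool :=
  match x, y with
  | _, None => true
  | None, Some _ => false
  | Some m, Some n => (m <= n)%N
  end.

(* The rank of A(F), where the extension [F] of [K] is embedded in [Omega] by
   [j].  It is finite for number fields, by the Mordell-Weil theorem. *)
Definition mw_rank (K Omega : fieldType) (iota : {rmorphism K -> Omega})
    (A : abelian_variety iota) (F : fieldType) (j : {rmorphism F -> Omega}) :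
    option nat :=
  rank (fun P : av_points A => rational j (val P)).

(* Main.v *)
Require Import Defs.
From Stdlib Require Import Classical ClassicalEpsilon.
From mathcomp Require Import all_boot all_order all_algebra all_fingroup all_field.
From mathcomp Require Import mpoly.

(** Suppose rk A(L) = rk A(K) + 1 = m + 1, and let N be the norm, i.e. the sum
    over G.  Some R in A(L) has N R = 0 and infinite order: otherwise |G| Q and
    N Q agree up to torsion for every Q in A(L), and then m + 1 independent
    points of A(L) have independent norms in A(K).  For g in G, the points R and
    g R and m independent points of A(K) satisfy a nontrivial relation; applying
    N kills the coefficients of the latter, so a R + b (g R) = 0.  As g has
    finite order, a = b or a = -b, so that g R = R or g R = -R up to torsion.
    Were the first to hold for all g, summing over G would make R torsion; so
    the g of the first kind form a subgroup of index 2.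

    G acts on L-rational points only, through their homogeneous coordinates;
    it respects addition because the group law is locally given by forms with
    coefficients in K. *)

Set Implicit Arguments.
Unset Strict Implicit.
Unset Printing Implicit Defensive.

Import Order.TTheory GRing.Theory Num.Theory.
Local Open Scope ring_scope.

(** * Independent families and torsion *)

Definition has_indep (U : zmodType) (S : U -> Prop) r : Prop :=
  exists P : 'I_r -> U, (forall i, S (P i)) /\ Zindependent P.

Lemma has_indep0 (U : zmodType) (S : U -> Prop) : has_indep S 0.
Proof. by exists (fun=> 0); split=> [[]|c _ []]. Qed.

Lemma has_indep_pred (U : zmodType) (S : U -> Prop) r :
  has_indep S r.+1 -> has_indep S r.
Proof.
case=> P [SP indP]; exists (fun i => P (lift ord0 i)); split=> // c c0 i.
(* The relation is extended by the coefficient 0 on the dropped point. *)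
have := indP (fun i => oapp c 0 (unlift ord0 i)).
rewrite big_ord_recl unlift_none mulr0z add0r.
under eq_bigr do rewrite liftK.
by move=> /(_ c0 (lift ord0 i)); rewrite liftK.
Qed.

Lemma has_indep_le (U : zmodType) (S : U -> Prop) r s :
  (r <= s)%N -> has_indep S s -> has_indep S r.
Proof.
move/subnKC <-; elim: (s - r)%N => [|k IHk]; first by rewrite addn0.
by rewrite addnS => /has_indep_pred.
Qed.

Lemma has_indep_sub (U : zmodType) (S T : U -> Prop) r :
  (forall x, S x -> T x) -> has_indep S r -> has_indep T r.
Proof. by move=> ST [P [SP indP]]; exists P; split=> // i; apply: ST. Qed.

Variant rank_spec (U : zmodType) (S : U -> Prop) : option nat -> Prop :=
| RankFin r of has_indep S r & ~ has_indep S r.+1 : rank_spec S (Some r)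
| RankInf of (forall r, has_indep S r) : rank_spec S None.

Lemma rankP (U : zmodType) (S : U -> Prop) : rank_spec S (rank S).
Proof.
rewrite /rank; case: excluded_middle_informative => [h|no_rank].
  case: constructive_indefinite_description => r /= [indr maxr].
  by constructor=> // -[P [SP /maxr]]; apply.
(* If the induction stopped at some [r], that [r] would be the rank; so independent families of
   every size exist. *)
constructor; elim=> [|r IHr]; first exact: has_indep0.
apply: NNPP => maxr; apply: no_rank; exists r; split=> // P SP indP.
by apply: maxr; exists P.
Qed.

Lemma not_Zindependent (U : zmodType) r (P : 'I_r -> U) :
  ~ Zindependent P ->
  exists2 c : 'I_r -> int, \sum_(i < r) P i *~ c i = 0 & exists i, c i != 0.
Proof.
move=> dep; have [c dep_c] := not_all_ex_not _ _ dep.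
have [c0 c_neq0] := imply_to_and _ _ dep_c.
have [i /eqP ci] := not_all_ex_not _ _ c_neq0.
by exists c => //; exists i.
Qed.

Definition torsion (U : zmodType) (x : U) : Prop :=
  exists2 k : int, k != 0 & x *~ k = 0.

Section Torsion.
Variable U : zmodType.
Implicit Types x y : U.

Lemma torsionD x y : torsion x -> torsion y -> torsion (x + y).
Proof.
move=> [k k0 xk] [l l0 yl]; exists (k * l); first by rewrite mulf_neq0.
by rewrite mulrzDl mulrzA xk mulrC mulrzA yl !mul0rz addr0.
Qed.

Lemma torsionN x : torsion x -> torsion (- x).
Proof. by move=> [k k0 xk]; exists k; rewrite // mulNrz xk oppr0. Qed.

Lemma torsion_mulrz x k : k != 0 -> torsion (x *~ k) -> torsion x.
Proof.
by move=> k0 [l l0 xkl]; exists (k * l); rewrite ?mulf_neq0 // mulrzA.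
Qed.
End Torsion.

(** * Maps that are additive on a subgroup only *)

Section AdditiveOn.
Variables (U : zmodType) (S : U -> Prop).
Hypotheses (S0 : S 0) (SD : forall x y, S x -> S y -> S (x + y)).
Hypothesis SN : forall x, S x -> S (- x).

Lemma closed_sum (I : finType) (P : pred I) (F : I -> U) :
  (forall i, S (F i)) -> S (\sum_(i | P i) F i).
Proof. by move=> SF; apply: big_rec => // i x _; apply: SD. Qed.

Lemma closed_mulrz x (k : int) : S x -> S (x *~ k).
Proof.
move=> Sx; have Sn n : S (x *+ n).
  by elim: n => [|n IHn]; rewrite ?mulr0n ?mulrS //; apply: SD.
by case: k => n; [rewrite -pmulrn | rewrite NegzE mulrNz -pmulrn; apply: SN].
Qed.

Variable h : U -> U.
Hypothesis hD : forall x y, S x -> S y -> h (x + y) = h x + h y.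

Lemma additive_on0 : h 0 = 0.
Proof. by apply: (addIr (h 0)); rewrite -hD // !add0r. Qed.

Lemma additive_onN x : S x -> h (- x) = - h x.
Proof.
move=> Sx; apply/eqP; rewrite -addr_eq0 -hD //; last exact: SN.
by rewrite addNr additive_on0.
Qed.

Lemma additive_on_sum (I : finType) (P : pred I) (F : I -> U) :
  (forall i, S (F i)) ->
  h (\sum_(i | P i) F i) = \sum_(i | P i) h (F i).
Proof.
move=> SF; suff [] : S (\sum_(i | P i) F i) /\
    h (\sum_(i | P i) F i) = \sum_(i | P i) h (F i) by [].
apply: (big_rec2 (fun x y => S x /\ h x = y)); first by rewrite additive_on0.
by move=> i x y _ [Sx <-]; split; [apply: SD | rewrite hD].
Qed.

Lemma additive_on_mulrz x (k : int) : S x -> h (x *~ k) = h x *~ k.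
Proof.
move=> Sx; have hn n : h (x *+ n) = h x *+ n.
  elim: n => [|n IHn]; rewrite ?mulr0n ?additive_on0 // !mulrS -IHn hD //.
  by rewrite pmulrn; apply: closed_mulrz.
case: k => n; rewrite -?pmulrn // NegzE !mulrNz -!pmulrn additive_onN ?hn //.
by rewrite pmulrn; apply: closed_mulrz.
Qed.
End AdditiveOn.

(** * Finite group actions raising the rank by one *)

Section GroupAction.
Variables (gT : finGroupType) (G : {group gT}) (U : zmodType) (S : U -> Prop).
Variable f : gT -> U -> U.
Hypotheses (S0 : S 0) (SD : forall x y, S x -> S y -> S (x + y)).
Hypothesis SN : forall x, S x -> S (- x).
Hypothesis fS : forall g x, S x -> S (f g x).
Hypothesis fD : forall g x y, S x -> S y -> f g (x + y) = f g x + f g y.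
Hypothesis f1 : forall x, S x -> f 1%g x = x.
(** A right action: products of automorphisms are read from left to right. *)
Hypothesis fM : forall g h x, S x -> f (g * h)%g x = f h (f g x).

Let fixed x := S x /\ {in G, forall g, f g x = x}.
Let norm x := \sum_(g in G) f g x.
Let Sz x k : S x -> S (x *~ k). Proof. exact: (closed_mulrz S0 SD SN). Qed.
Let fz g x k : S x -> f g (x *~ k) = f g x *~ k.
Proof. exact: (additive_on_mulrz S0 SD SN (@fD g)). Qed.
Let fN g x : S x -> f g (- x) = - f g x.
Proof. exact: (additive_onN S0 SN (@fD g)). Qed.

Let norm_fixed x : S x -> fixed (norm x).
Proof.
move=> Sx; split=> [|h Gh]; first by apply: closed_sum => // g; apply: fS.
rewrite /norm (additive_on_sum S0 SD (@fD h)); last by move=> g; apply: fS.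
rewrite [RHS](reindex_inj (mulIg h)) /=.
by apply: eq_big => [g|g Gg]; rewrite ?groupMr ?fM.
Qed.

Let norm_act h x : h \in G -> S x -> norm (f h x) = norm x.
Proof.
move=> Gh Sx; rewrite /norm [RHS](reindex_inj (mulgI h)) /=.
by apply: eq_big => [g|g Gg]; rewrite ?groupMl ?fM.
Qed.

Let norm_of_fixed x : fixed x -> norm x = x *~ #|G|%:Z.
Proof.
case=> Sx fx; rewrite /norm (eq_bigr (fun=> x)) => [|g /fx //].
by rewrite sumr_const pmulrn.
Qed.

Let normD x y : S x -> S y -> norm (x + y) = norm x + norm y.
Proof.
by move=> Sx Sy; rewrite -big_split; apply: eq_bigr => g _; rewrite fD.
Qed.

Let normz x k : S x -> norm (x *~ k) = norm x *~ k.
Proof. exact: (additive_on_mulrz S0 SD SN normD). Qed.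

Let G_neq0 : #|G|%:Z != 0.
Proof. by rewrite -lt0n cardG_gt0. Qed.

Let torsion_act g x : S x -> torsion x -> torsion (f g x).
Proof.
move=> Sx [k k0 xk]; exists k; rewrite // -fz // xk.
exact: (additive_on0 S0 (@fD g)).
Qed.

(** [N] multiplies fixed points by [|G|], so it kills every difference [|G| Q - N Q]. To be used
    with [m] one above the rank of the fixed points. *)
Let norm_zero_nontorsion m :
  has_indep S m -> ~ has_indep fixed m ->
  exists R, [/\ S R, ~ torsion R & norm R = 0].
Proof.
case=> Q [SQ indQ] no_fixed; apply: NNPP => no_R; apply: no_fixed.
pose R j := Q j *~ #|G|%:Z - norm (Q j).
have torR j : torsion (R j).
  apply: NNPP => ntR; apply: no_R; exists (R j).
  have [SnQ _] := norm_fixed (SQ j).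
  have SnQ' := SN SnQ.
  split=> //; first by apply: SD => //; apply: Sz.
  rewrite normD ?normz //; last exact: Sz.
  have -> : norm (- norm (Q j)) = - norm (norm (Q j)).
    exact: (additive_onN S0 SN normD).
  by rewrite (norm_of_fixed (norm_fixed (SQ j))) subrr.
have /fin_all_exists2[k k0 Rk] : forall j, exists2 k : int, k != 0 & R j *~ k = 0.
  exact: torR.
(* [k1] annihilates every [R j] at once, so [N (Q j)] and [|G| Q j] agree after multiplication by
   it. *)
pose k1 := \prod_j k j.
have k1_neq0 : k1 != 0 by apply/prodf_neq0 => j _; apply: k0.
have Rk1 j : norm (Q j) *~ k1 = Q j *~ (#|G|%:Z * k1).
  apply/esym/eqP; rewrite mulrzA -subr_eq0 -mulrzBl -/(R j).
  by rewrite /k1 (bigD1 j) //= mulrzA Rk mul0rz.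
exists (fun j => norm (Q j)); split=> [j|c c0 j]; first exact: norm_fixed.
(* A relation between the norms, multiplied by [k1], becomes one between the [Q j] with coefficients
   [|G| k1 c j]. *)
have /(_ _ j)/eqP := indQ (fun j => (#|G|%:Z * k1) * c j).
rewrite !mulf_eq0 (negPf G_neq0) (negPf k1_neq0) /= => /(_ _)/eqP; apply.
have c0k : (\sum_i norm (Q i) *~ c i) *~ k1 = 0 by rewrite c0 mul0rz.
rewrite -[RHS]c0k mulrz_suml; apply: eq_bigr => i _.
by rewrite mulrzA -Rk1 -!mulrzA mulrC.
Qed.

Let eigen_pm1 m R g :
    has_indep fixed m -> ~ has_indep S m.+2 ->
    S R -> ~ torsion R -> norm R = 0 -> g \in G ->
  torsion (f g R - R) \/ torsion (f g R + R).
Proof.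
move=> [P [fixP indP]] maxS SR ntR nR0 Gg.
have SP i : S (P i) by case: (fixP i).
(* [R], [g R] and the [m] fixed points: [m + 2] points of [S], hence dependent. *)
pose Q (i : 'I_m.+2) :=
  if unlift ord0 i is Some j then
    if unlift ord0 j is Some k then P k else f g R
  else R.
have SQ i : S (Q i).
  by rewrite /Q; case: unlift => // j; case: unlift => [k|]; [apply: SP|apply: fS].
have [|c c0 [i ci]] := @not_Zindependent _ _ Q.
  by move=> indQ; apply: maxS; exists Q.
move: c0; rewrite !big_ord_recl /Q unlift_none liftK unlift_none.
under eq_bigr do rewrite !liftK.
set a := c ord0; set b := c _; set d := fun k => c (lift ord0 (lift ord0 k)).
rewrite -/d => c0.
have SPd : S (\sum_k P k *~ d k) by apply: closed_sum => // k; apply: Sz.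
have Sa := Sz a SR; have Sb := Sz b (fS g SR).
(* [N] kills [R] and [g R], and multiplies the rest of the relation, which is fixed, by [|G|]. *)
have pG : (\sum_k P k *~ d k) *~ #|G|%:Z = 0.
  rewrite -norm_of_fixed.
    have : norm (R *~ a + (f g R *~ b + \sum_k P k *~ d k)) = 0.
      by rewrite c0; exact: (additive_on0 S0 normD).
    rewrite !normD ?normz ?norm_act ?nR0 ?mul0rz ?add0r //; first exact: fS.
    exact: SD.
  split=> // h Gh; rewrite (additive_on_sum S0 SD (@fD h)) => [|k]; last exact: Sz.
  by apply: eq_bigr => k _; rewrite fz //; case: (fixP k) => _ ->.
have d0 k : d k = 0.
  have /(_ _ k)/eqP := indP (fun k => d k * #|G|%:Z).
  rewrite mulf_eq0 (negPf G_neq0) orbF => d0; apply/eqP/d0.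
  rewrite -[RHS]pG mulrz_suml; apply: eq_bigr => l _; exact: mulrzA.
move: c0; rewrite big1 ?addr0 => [ab0|k _]; last by rewrite -/(d k) d0 mulr0z.
(* If [b = 0] then [a R = 0], so [a = 0] as [R] is not torsion, and the whole relation is
   trivial. *)
have b0 : b != 0.
  apply/eqP => b0; move: ab0; rewrite b0 mulr0z addr0 => aR0.
  have a0 : a = 0.
    by apply/eqP/negPn/negP => a0; apply: ntR; exists a.
  case/negP: ci.
  case: (unliftP ord0 i) => [j ->|->]; last by rewrite -/a a0.
  case: (unliftP ord0 j) => [k ->|->]; last by rewrite -/b b0.
  by rewrite -/(d k) d0.
(* The relation [b (g R) = - a R] is iterated along the powers of [g]. *)
have orbitR n : f (g ^+ n)%g R *~ (b ^+ n) = R *~ ((- a) ^+ n).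
  elim: n => [|n IHn]; first by rewrite expg0 f1.
  rewrite expgSr fM // exprSr mulrzA -fz; last exact: fS.
  rewrite IHn fz // -mulrzA mulrC mulrzA exprS mulrzA; congr (_ *~ _).
  by apply/eqP; rewrite mulrNz -addr_eq0 addrC ab0.
(* When [n] is the order of [g], this reads [(b^n - (-a)^n) R = 0]; as [R] is not torsion,
   [b^n = (-a)^n], and [n > 0] gives equal absolute values. *)
have eq_norm : `|b| = `|a|.
  rewrite -[RHS]normrN; apply/eqP; rewrite -(eqrXn2 (order_gt0 g)) // -!normrX.
  have := orbitR #[g]%g; rewrite expg_order f1 // => /eqP.
  rewrite -subr_eq0 -mulrzBr => /eqP Rz.
  case: (eqVneq (b ^+ #[g]%g - (- a) ^+ #[g]%g) 0) => [/eqP|nz].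
    by rewrite subr_eq0 => /eqP->.
  by case: ntR; exists (b ^+ #[g]%g - (- a) ^+ #[g]%g).
have [eab|eab] : a = - b \/ a = b.
  by move/eqP: eq_norm; rewrite eqr_norm2 => /orP[/eqP->|/eqP->]; rewrite ?opprK; auto.
- left; exists b => //; move: ab0.
  by rewrite eab mulrNz mulrzBl addrC.
- by right; exists b => //; move: ab0; rewrite eab mulrzDl addrC.
Qed.

Lemma index2_subgroup m :
    has_indep S m.+1 -> ~ has_indep S m.+2 ->
    has_indep fixed m -> ~ has_indep fixed m.+1 ->
  exists2 H : {group gT}, H \subset G & #|G : H|%g = 2%N.
Proof.
move=> indS maxS indF maxF.
have [R [SR ntR nR0]] := norm_zero_nontorsion indS maxF.
have pm1 g : g \in G -> torsion (f g R - R) \/ torsion (f g R + R).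
  exact: (eigen_pm1 indF maxS SR ntR nR0).
have SfR g : S (f g R) by apply: fS.
have SNR := SN SR.
(* Torsion is decided classically, so that [H] can be formed as a finite set. *)
pose tors_b x := if excluded_middle_informative (@torsion U x) then true else false.
have torsP x : reflect (torsion x) (tors_b x).
  by rewrite /tors_b; case: excluded_middle_informative => h; constructor.
pose H := [set g in G | tors_b (f g R - R)].
have gH : group_set H.
  apply/group_setP; split=> [|g h].
    by rewrite inE group1 f1 // subrr; apply/torsP; exists 1.
  rewrite !inE => /andP[Gg /torsP tg] /andP[Gh /torsP th].
  rewrite groupM //= fM //; apply/torsP.
  have -> : f h (f g R) - R = f h (f g R - R) + (f h R - R).
    by rewrite fD // fN // addrA subrK.
  by apply: torsionD => //; apply: torsion_act => //; apply: SD.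
pose K := Group gH.
have inK g : (g \in K) = (g \in G) && tors_b (f g R - R) by rewrite inE.
have sHG : K \subset G by apply/subsetP => g; rewrite inK => /andP[].
(* Were [K] all of [G], the sum of all [g R - R], which is [N R - |G| R = - |G| R], would be
   torsion. *)
have [x Gx Hx] : exists2 x, x \in G & x \notin K.
  apply/exists_inP; rewrite -negb_forall_in; apply/forall_inP => allH.
  apply: ntR; apply: (@torsion_mulrz _ _ #|G|%:Z G_neq0).
  have -> : R *~ #|G|%:Z = - (\sum_(g in G) (f g R - R)).
    by rewrite sumrB -/(norm R) nR0 sub0r opprK sumr_const pmulrn.
  apply: torsionN; apply: (big_rec (@torsion U)); first by exists 1.
  move=> g y Gg; apply: torsionD.
  by have := allH g Gg; rewrite inK Gg => /torsP.
exists K => //.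
have GH : G :\: K = (K :* x)%g.
  apply/setP => g; rewrite inE mem_rcoset.
  have [Gg|Gg] := boolP (g \in G); last first.
    rewrite andbF; apply/esym/negP => /(subsetP sHG).
    by rewrite groupMr ?groupV // (negPf Gg).
  have minus h : h \in G -> h \notin K -> torsion (f h R + R).
    move=> Gh; rewrite inK Gh /= => /torsP nt.
    by case: (pm1 _ Gh).
  rewrite andbT; apply/idP/idP => [nHg|Hgx]; last first.
    apply: contra Hx => Hg.
    have := groupM (groupVr Hgx) Hg.
    by rewrite invMg invgK mulgKV.
  rewrite inK groupM ?groupV //=; apply/torsP; rewrite fM //.
  have tx : torsion (f x^-1%g (f x R + R)).
    by apply: torsion_act (minus _ Gx Hx); apply: SD.
  have tg : torsion (f x^-1%g (f g R + R)).
    by apply: torsion_act (minus _ Gg nHg); apply: SD.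
  (* Both [g] and [x] negate [R] up to torsion, so [g x^-1] fixes it up to torsion; hence the
     complement of [K] is a single coset. *)
  have -> : f x^-1%g (f g R) - R
      = f x^-1%g (f g R + R) + - f x^-1%g (f x R + R).
    rewrite !fD // -(fM x x^-1%g) // mulgV f1 // opprD addrACA.
    by rewrite subrr addr0.
  by apply: torsionD => //; apply: torsionN.
have cGH : #|G| = (#|K| * 2)%N.
  rewrite -(cardsID H G) (setIidPr sHG) GH card_rcoset.
  by rewrite muln2 addnn.
have := Lagrange sHG.
rewrite cGH => /eqP; rewrite eqn_pmul2l; first by move/eqP.
exact: (cardG_gt0 K).
Qed.
End GroupAction.

(** * Conjugates of rational points *)

Section MapMpoly.
Variables (R S : comNzRingType) (phi : {rmorphism R -> S}) (n : nat).
Implicit Type p : {mpoly R[n]}.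

Lemma meval_map_mpoly p (x : 'I_n -> S) :
  (map_mpoly phi p).@[x]
    = \sum_(a <- msupp p) phi p@_a * \prod_(i < n) x i ^+ a i.
Proof.
rewrite /map_mpoly /mmap raddf_sum /=; apply: eq_bigr => a _.
by rewrite mmap1_id mul_mpolyC mevalZ mevalX.
Qed.

(** One factor per variable: a constant [c] serves homogeneous forms, a [c] constant on each block
    of coordinates serves bihomogeneous ones. *)
Lemma meval_map_mpoly_scale p (c x : 'I_n -> S) (k : S) :
    {in msupp p, forall a : 'X_{1..n}, \prod_(i < n) c i ^+ a i = k} ->
  (map_mpoly phi p).@[fun i => c i * x i] = k * (map_mpoly phi p).@[x].
Proof.
move=> ck; rewrite !meval_map_mpoly mulr_sumr !big_seq.
apply: eq_bigr => a /ck <-; rewrite mulrCA; congr (_ * _).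
by rewrite -big_split; apply: eq_bigr => i _; rewrite exprMn.
Qed.
End MapMpoly.

(** For an automorphism [s] of [L] over [K], this makes evaluation of polynomials over [K] commute
    with conjugation. *)
Lemma rmorph_meval_map (R S T : comNzRingType) (h : {rmorphism R -> S})
    (s : {rmorphism S -> T}) (phi : {rmorphism R -> T}) n
    (p : {mpoly R[n]}) (x : 'I_n -> S) :
    (forall c, s (h c) = phi c) ->
  (map_mpoly phi p).@[fun i => s (x i)] = s (map_mpoly h p).@[x].
Proof.
move=> sh; rewrite !meval_map_mpoly rmorph_sum; apply: eq_bigr => a _.
rewrite rmorphM rmorph_prod sh; congr (_ * _).
by apply: eq_bigr => i _; rewrite rmorphXn.
Qed.

(** * Lines and homogeneous coordinates *)

Section Line.
Variables (F : fieldType).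

Lemma line_eqP n (v w : 'rV[F]_n) :
  v != 0 -> <[v]>%VS = <[w]>%VS -> exists2 c, c != 0 & v = c *: w.
Proof.
move=> v0 vw; have /vlineP[c vE] : v \in <[w]>%VS by rewrite -vw memv_line.
by exists c => //; apply: contraNneq v0 => c0; rewrite vE c0 scale0r.
Qed.

Lemma line_scale n (c : F) (w : 'rV[F]_n) : c != 0 -> <[c *: w]>%VS = <[w]>%VS.
Proof.
move=> c0; apply/eqP; rewrite eqEsubv -!memvE memvZ ?memv_line //=.
by apply/vlineP; exists c^-1; rewrite scalerA mulVf ?scale1r.
Qed.

(** [hcoord] is an arbitrary choice; computations replace it by a known spanning vector at the price
    of a scalar. *)
Lemma hcoord_line n (P : proj F n) w :
  w != 0 -> val P = <[w]>%VS -> exists2 c, c != 0 & hcoord P = c *: w.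
Proof.
move=> w0 Pw; apply: line_eqP; rewrite /hcoord Pw.
  by rewrite vpick0 -dimv_eq0 dim_vline w0.
apply/eqP; rewrite eqEdim -memvE memv_pick !dim_vline w0.
by rewrite vpick0 -dimv_eq0 dim_vline w0.
Qed.
End Line.

Section Evalv.
Variables (K F : fieldType) (phi : {rmorphism K -> F}).

Lemma meval_homog n d (p : {mpoly K[n]}) (c : F) (x : 'rV[F]_n) :
  p \is d.-homog ->
  (map_mpoly phi p).@[(c *: x) 0] = c ^+ d * (map_mpoly phi p).@[x 0].
Proof.
move=> /dhomogP hp; rewrite -(@meval_map_mpoly_scale _ _ _ _ _ (fun=> c)).
  by apply: meval_eq => i; rewrite mxE.
by move=> a /hp <-; rewrite prodrXr -mdegE.
Qed.

Lemma evalv_scale n m d (f : 'I_m.+1 -> {mpoly K[n]}) (c : F) (x : 'rV[F]_n) :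
  (forall i, f i \is d.-homog) -> evalv phi f (c *: x) = c ^+ d *: evalv phi f x.
Proof. by move=> hf; apply/rowP => i; rewrite !mxE (meval_homog _ _ (hf i)). Qed.

Lemma evalv_bihomog n m l d e (f : 'I_l.+1 -> {mpoly K[n.+1 + m.+1]})
    (a b : F) (x : 'rV[F]_n.+1) (y : 'rV[F]_m.+1) :
    (forall i, bihomogeneous d e (f i)) ->
  evalv phi f (row_mx (a *: x) (b *: y))
    = (a ^+ d * b ^+ e) *: evalv phi f (row_mx x y).
Proof.
move=> hf; apply/rowP => i; rewrite !mxE.
pose c (k : 'I_(n.+1 + m.+1)) := if split k is inl _ then a else b.
rewrite -(@meval_map_mpoly_scale _ _ _ _ _ c).
  apply: meval_eq => k; rewrite !mxE /c.
  by case: split => k'; rewrite !mxE.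
move=> u /(hf i)[<- <-]; rewrite big_split_ord /=; congr (_ * _).
  rewrite -prodrXr; apply: eq_bigr => k _; rewrite /c.
  by rewrite -[lshift _ k]/(unsplit (inl k)) unsplitK.
rewrite -prodrXr; apply: eq_bigr => k _; rewrite /c.
by rewrite -[rshift _ k]/(unsplit (inr k)) unsplitK.
Qed.

Lemma locus_line n (eqs : seq {mpoly K[n.+1]}) (P : proj F n) w :
    {in eqs, forall p, p \is homog mdeg} -> w != 0 -> val P = <[w]>%VS ->
  locus phi eqs P = all (fun p => (map_mpoly phi p).@[w 0] == 0) eqs.
Proof.
move=> heqs w0 Pw; have [c c0 Pc] := hcoord_line w0 Pw.
rewrite /locus /zeros all_map; apply: eq_in_all => p /heqs/homogP[d hp] /=.
by rewrite Pc (meval_homog _ _ hp) mulf_eq0 expf_eq0 (negPf c0) andbF.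
Qed.
End Evalv.

Lemma map_evalv (K L F : fieldType) (h : {rmorphism K -> L})
    (s : {rmorphism L -> F}) (phi : {rmorphism K -> F}) n m
    (f : 'I_m.+1 -> {mpoly K[n]}) (x : 'rV[L]_n) :
    (forall c, s (h c) = phi c) ->
  evalv phi f (map_mx s x) = map_mx s (evalv h f x).
Proof.
move=> sh; apply/rowP => i; rewrite !mxE -(rmorph_meval_map _ _ sh).
by apply: meval_eq => k; rewrite mxE.
Qed.

(** * Galois conjugation of [L]-rational points *)

Section Conjugation.
Variables (K L Omega : fieldType) (h : {rmorphism K -> L}).
Variables (j : {rmorphism L -> Omega}) (phi : {rmorphism K -> Omega}).
Hypothesis jh : forall c, j (h c) = phi c.
Variables (n : nat) (eqs : seq {mpoly K[n.+1]}).
Hypothesis eqs_homog : {in eqs, forall p, p \is homog mdeg}.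
Implicit Types (P Q : points phi eqs) (s t : {rmorphism L -> L}).

(* [Q] is the conjugate of the [L]-rational point [P] by [s]; no extension of
   [s] to [Omega] is involved. *)
Definition conjugate (s : L -> L) P Q : Prop :=
  exists v : 'rV[L]_n.+1, [/\ v != 0, val (val P) = <[map_mx j v]>%VS
    & val (val Q) = <[map_mx j (map_mx s v)]>%VS].

(** The conjugate does not depend on the vector: two [L]-vectors proportional over [Omega] are
    already proportional over [L]. *)
Lemma conjugate_line s P Q v : v != 0 -> val (val P) = <[map_mx j v]>%VS ->
  conjugate s P Q -> val (val Q) = <[map_mx j (map_mx s v)]>%VS.
Proof.
move=> v0 Pv [w [w0 Pw ->]].
have [||c c0 vw] := @line_eqP _ _ (map_mx j v) (map_mx j w).
- by rewrite map_mx_eq0.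
- by rewrite -Pv Pw.
have [i wi] : exists i, w 0 i != 0 by apply/rV0Pn.
(* The scalar is a quotient of coordinates of the two vectors, so it comes from [L] and [s] applies
   to it. *)
have cE : c = j (v 0 i / w 0 i).
  have /rowP/(_ i) := vw; rewrite !mxE fmorph_div => ->.
  by rewrite mulfK // fmorph_eq0.
have -> : v = (v 0 i / w 0 i) *: w.
  by apply: (@map_mx_inj _ _ j); rewrite vw map_mxZ -cE.
rewrite !map_mxZ line_scale // !fmorph_eq0.
by rewrite -(fmorph_eq0 j) -cE.
Qed.

Lemma conjugate_inj s P Q Q' :
  conjugate s P Q -> conjugate s P Q' -> Q = Q'.
Proof.
move=> [v [v0 Pv Qv]] /(conjugate_line v0 Pv) Q'v.
by do 2!apply: val_inj; rewrite /= Qv Q'v.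
Qed.

Lemma conjugate_rationall s P Q : conjugate s P Q -> rational j (val P).
Proof. by case=> v [v0 Pv _]; exists v. Qed.

Lemma conjugate_rationalr s P Q : conjugate s P Q -> rational j (val Q).
Proof.
by case=> v [v0 _ Qv]; exists (map_mx s v); rewrite ?map_mx_eq0.
Qed.

Lemma conjugate_id (s : L -> L) P : s =1 id -> rational j (val P) -> conjugate s P P.
Proof.
move=> s1 [v v0 Pv]; exists v; split=> //.
by have -> : map_mx s v = v by apply/matrixP => i k; rewrite mxE s1.
Qed.

Lemma conjugate_comp s t (st : L -> L) P Q R : (forall x, st x = t (s x)) ->
  conjugate s P Q -> conjugate t Q R -> conjugate st P R.
Proof.
move=> stE [v [v0 Pv Qv]] cQR; exists v; split=> //.
have -> : map_mx st v = map_mx t (map_mx s v).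
  by apply/matrixP => i k; rewrite !mxE stE.
by apply: conjugate_line cQR; rewrite ?map_mx_eq0.
Qed.

Section OverK.
Variable s : {rmorphism L -> L}.
Hypothesis sh : forall c, s (h c) = h c.

(** The equations have coefficients in [K], which [s] fixes, so the conjugated coordinates still
    satisfy them. *)
Lemma conjugate_exists P : rational j (val P) -> exists Q, conjugate s P Q.
Proof.
case=> v v0 Pv; pose w := map_mx j (map_mx s v).
have w0 : w != 0 by rewrite !map_mx_eq0.
have dimw : \dim <[w]> == 1%N by rewrite dim_vline w0.
have locw : locus phi eqs (exist _ <[w]>%VS dimw).
  rewrite (locus_line phi eqs_homog w0) //.
  have := valP P; rewrite (locus_line phi eqs_homog _ Pv) ?map_mx_eq0 //.
  have vanish (x : 'rV[L]_n.+1) p :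
      ((map_mpoly phi p).@[map_mx j x 0] == 0) = ((map_mpoly h p).@[x 0] == 0).
    rewrite -(fmorph_eq0 j) -(rmorph_meval_map _ _ jh).
    by congr (_ == 0); apply: meval_eq => i; rewrite mxE.
  move/allP => vP; apply/allP => p /vP; rewrite !vanish.
  rewrite -(fmorph_eq0 s) -(rmorph_meval_map _ _ sh) => /eqP <-.
  by apply/eqP/meval_eq => i; rewrite mxE.
by exists (exist _ (exist _ <[w]>%VS dimw) locw), v; split.
Qed.

(** Up to nonzero scalars, forms representing [f] near [P] take at [Q] the conjugate of their value
    at [P]; so they do not all vanish at [Q] and compute [f Q] too. *)
Lemma conjugate_morphism1 f P Q :
  morphism1 f -> conjugate s P Q -> conjugate s (f P) (f Q).
Proof.
move=> mf [v [v0 Pv Qv]]; have [d [F [hF nz fE]]] := mf P.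
have sv0 : map_mx s v != 0 by rewrite map_mx_eq0.
have jv0 : map_mx j v != 0 by rewrite map_mx_eq0.
have jsv0 : map_mx j (map_mx s v) != 0 by rewrite map_mx_eq0.
have [a a0 Pa] := hcoord_line jv0 Pv; have [b b0 Qb] := hcoord_line jsv0 Qv.
have EP : evalv phi F (Defs.coord P) = a ^+ d *: map_mx j (evalv h F v).
  by rewrite /Defs.coord Pa (evalv_scale _ _ _ hF) (map_evalv _ _ jh).
have EQ : evalv phi F (Defs.coord Q) = b ^+ d *: map_mx j (map_mx s (evalv h F v)).
  rewrite /Defs.coord Qb (evalv_scale _ _ _ hF).
  by rewrite (map_evalv _ _ jh) (map_evalv _ _ sh).
have ev0 : evalv h F v != 0.
  by apply: contraNneq nz => e0; rewrite EP e0 map_mx0 scaler0.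
exists (evalv h F v); split=> //.
  by rewrite fE // EP line_scale // expf_neq0.
by rewrite fE EQ ?line_scale // ?scaler_eq0 ?negb_or ?map_mx_eq0 ?expf_neq0.
Qed.

Lemma conjugate_morphism2 f P P' Q Q' : morphism2 f ->
  conjugate s P Q -> conjugate s P' Q' -> conjugate s (f P P') (f Q Q').
Proof.
move=> mf [v [v0 Pv Qv]] [v' [v'0 Pv' Qv']].
have [d [e [F [hF nz fE]]]] := mf P P'.
have jv0 w : w != 0 -> map_mx j w != 0 :> 'rV_n.+1 by rewrite map_mx_eq0.
have sv0 w : w != 0 -> map_mx s w != 0 :> 'rV_n.+1 by rewrite map_mx_eq0.
have [a a0 Pa] := hcoord_line (jv0 _ v0) Pv.
have [b b0 Qb] := hcoord_line (jv0 _ (sv0 _ v0)) Qv.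
have [a' a'0 Pa'] := hcoord_line (jv0 _ v'0) Pv'.
have [b' b'0 Qb'] := hcoord_line (jv0 _ (sv0 _ v'0)) Qv'.
pose w := evalv h F (row_mx v v').
have EP : evalv phi F (row_mx (Defs.coord P) (Defs.coord P'))
    = (a ^+ d * a' ^+ e) *: map_mx j w.
  rewrite /Defs.coord Pa Pa' (evalv_bihomog _ _ _ _ _ hF) -map_row_mx.
  by rewrite (map_evalv _ _ jh).
have EQ : evalv phi F (row_mx (Defs.coord Q) (Defs.coord Q'))
    = (b ^+ d * b' ^+ e) *: map_mx j (map_mx s w).
  rewrite /Defs.coord Qb Qb' (evalv_bihomog _ _ _ _ _ hF) -!map_row_mx.
  by rewrite (map_evalv _ _ jh) (map_evalv _ _ sh).
have w0 : w != 0.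
  by apply: contraNneq nz => e0; rewrite EP e0 map_mx0 scaler0.
exists w; split=> //.
  by rewrite fE // EP line_scale // mulf_neq0 ?expf_neq0.
by rewrite fE EQ ?line_scale // ?scaler_eq0 ?negb_or ?map_mx_eq0 ?mulf_neq0 ?expf_neq0.
Qed.
End OverK.

Lemma conjugate_rational s P : (forall c, s (h c) = h c) ->
  rational phi (val P) -> conjugate s P P.
Proof.
move=> sh [v v0 Pv].
have phiE : map_mx phi v = map_mx j (map_mx h v).
  by apply/matrixP => i k; rewrite !mxE jh.
exists (map_mx h v); rewrite map_mx_eq0 -phiE; split=> //.
rewrite Pv phiE; congr (<[map_mx j _]>%VS).
by apply/matrixP => i k; rewrite !mxE sh.
Qed.

(** Galois descent: with one coordinate scaled to 1, conjugation can only multiply the vector by 1,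
    so every coordinate is fixed and comes from [K]. *)
Lemma rational_fixed (T : Type) (s : T -> {rmorphism L -> L}) P :
    (forall x, (forall g, s g x = x) -> exists c, x = h c) ->
    rational j (val P) -> (forall g, conjugate (s g) P P) ->
  rational phi (val P).
Proof.
move=> fixK [v v0 Pv] fixP.
have [i vi] : exists i, v 0 i != 0 by apply/rV0Pn.
pose w := (v 0 i)^-1 *: v.
have wi : w 0 i = 1 by rewrite mxE mulVf.
have w0 : w != 0 by apply/rV0Pn; exists i; rewrite wi oner_neq0.
have Pw : val (val P) = <[map_mx j w]>%VS.
  by rewrite map_mxZ line_scale ?fmorph_eq0 ?invr_eq0.
have fixw g k : s g (w 0 k) = w 0 k.
  have := conjugate_line w0 Pw (fixP g); rewrite Pw => sw.
  have [|c c0 wc] := line_eqP _ sw; first by rewrite map_mx_eq0.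
  have /rowP/(_ i) := wc; rewrite !mxE mulVf // !rmorph1 mulr1 => c1.
  have /rowP/(_ k) := wc; rewrite -c1 scale1r !mxE.
  by move/(fmorph_inj j).
have /fin_all_exists[u uE] : forall k, exists c, w 0 k = h c.
  by move=> k; apply: fixK => g.
have wE : map_mx phi (\row_k u k) = map_mx j w.
  by apply/rowP => k; rewrite !mxE -jh -uE mxE.
exists (\row_k u k); last by rewrite wE.
by rewrite -(map_mx_eq0 phi) wE map_mx_eq0.
Qed.
End Conjugation.

(** * Comparison of the two ranks *)

Lemma rank_jump (U : zmodType) (S T : U -> Prop) :
    (forall x, S x -> T x) ->
    (forall m, has_indep S m -> ~ has_indep S m.+1 ->
       has_indep T m.+1 -> has_indep T m.+2) ->
  rank T = rank S \/ enat_le (enat_add (rank S) 2) (rank T).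
Proof.
move=> ST jump; case: (rankP S) => [m indS maxS|infS]; last first.
  (* [T] contains [S], so it also has independent families of every size: both ranks are
     infinite. *)
  left; case: (rankP T) => // r _ []; exact: has_indep_sub (infS _).
case: (rankP T) => [r indT maxT|]; last by right.
have lemr : (m <= r)%N.
  rewrite leqNgt; apply/negP => ltrm; apply: maxT.
  by apply: has_indep_le ltrm _; apply: has_indep_sub indS.
case: (ltngtP m r) lemr => // [ltmr _|-> _]; last by left.
(* Otherwise [r = m + 1], and [m + 2] independent points of [T] contradict the maximality of [r]. *)
right; rewrite /= addn2 ltnNge; apply/negP => lerm; apply: maxT.
apply: has_indep_le (_ : (r.+1 <= m.+2)%N) _; first by rewrite ltnS.
by apply: jump => //; apply: has_indep_le indT.
Qed.

Theorem theorem2p8 (K : fieldExtType rat) (L : splittingFieldType K)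
    (Omega : closedFieldType) (iota : {rmorphism L -> Omega})
    (Omega_alg : forall x : Omega, algebraicOver iota x)
    (galLK : galois 1%AS {:L}%AS)
    (no_index2 : ~ exists2 H : {group gal_of {:L}%AS},
        H \subset ('Gal({:L}%AS / 1%AS))%g & #|('Gal({:L}%AS / 1%AS))%g : H|%g = 2%N)
    (A : abelian_variety (iota \o GRing.in_alg L)%FUN) :
  mw_rank A iota = mw_rank A (iota \o GRing.in_alg L)%FUN \/
  enat_le (enat_add (mw_rank A (iota \o GRing.in_alg L)%FUN) 2) (mw_rank A iota).
Proof.
pose phi : {rmorphism K -> Omega} := (iota \o GRing.in_alg L)%FUN.
pose h : {rmorphism K -> L} := GRing.in_alg L.
have jh c : iota (h c) = phi c by [].
have sh (g : gal_of {:L}) c : g (h c) = h c by rewrite /h /= linearZ rmorph1.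
pose conj (g : gal_of {:L}) := @conjugate K L Omega iota phi _ (av_eqs A) g.
pose S (P : av_points A) := rational iota (val P).
(* Guarding by [S P] lets choice produce a map on all points; its values off the [L]-rational ones
   are arbitrary. *)
have conj_ex g (P : av_points A) : exists Q : av_points A, S P -> conj g P Q.
  have [SP|nSP] := classic (S P); last by exists P.
  have [Q cPQ] := conjugate_exists jh (@av_homog _ _ _ A) (sh g) SP.
  by exists Q.
pose f g P : av_points A :=
  proj1_sig (constructive_indefinite_description _ (conj_ex g P)).
have fP g P : S P -> conj g P (f g P).
  by rewrite /f; case: constructive_indefinite_description.
(* Conjugates are unique, so identities for [f] reduce to properties of the relation [conj]. *)
have fE g P Q : conj g P Q -> f g P = Q.
  move=> cPQ; have SP : S P := conjugate_rationall cPQ.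
  exact: conjugate_inj (fP g P SP) cPQ.
have conjD g (P P' Q Q' : av_points A) :
    conj g P Q -> conj g P' Q' -> conj g (P + P') (Q + Q').
  exact: (conjugate_morphism2 jh (sh g) (@av_add_morphism _ _ _ A)).
have conj1 (P : av_points A) : S P -> conj 1%g P P.
  by apply: conjugate_id => x; rewrite gal_id.
have SK (P : av_points A) : rational phi (val P) -> forall g, conj g P P.
  by move=> KP g; apply: (conjugate_rational jh (sh g)).
have KS (P : av_points A) : rational phi (val P) -> S P.
  by move/SK/(_ 1%g)/conjugate_rationall.
have S0 : S 0 by apply/KS/av_zero_rational.
(* Only rational points take part in a conjugation, so conjugating by the identity shows that sums
   and opposites stay [L]-rational. *)
have SD P Q : S P -> S Q -> S (P + Q).
  by move=> /conj1 cP /conj1 cQ; exact: conjugate_rationall (conjD _ _ _ _ _ cP cQ).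
have SN P : S P -> S (- P).
  move=> /conj1 cP.
  apply: conjugate_rationall.
  exact: (conjugate_morphism1 jh (sh 1%g) (@av_opp_morphism _ _ _ A) cP).
have fS g P : S P -> S (f g P) by move/(fP g)/conjugate_rationalr.
have fD g P Q : S P -> S Q -> f g (P + Q) = f g P + f g Q.
  by move=> SP SQ; apply/fE/conjD; apply: fP.
have f1 P : S P -> f 1%g P = P by move=> /conj1/fE.
have fM g g' P : S P -> f (g * g')%g P = f g' (f g P).
  move=> SP; apply: fE; apply: conjugate_comp (fP g _ SP) (fP g' _ (fS g _ SP)).
  by move=> x; rewrite galM ?memvf.
have galT g : g \in ('Gal({:L}%AS / 1%AS))%g.
  rewrite gal_kHom ?sub1v //; apply/kAHomP => x /vlineP[c ->].
  exact: sh.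
have fixedE P : (S P /\ {in ('Gal({:L}%AS / 1%AS))%g, forall g, f g P = P})
    <-> rational phi (val P).
  split=> [[SP fixP]|KP]; last first.
    by split=> [|g _]; [apply: KS | apply/fE/SK].
  apply: (@rational_fixed _ _ _ h iota phi jh _ _ (gal_of {:L})
    (fun g => g : {rmorphism L -> L})) (SP) _ => [x fixx|g].
    (* The extension is Galois, so the field fixed by the whole group is [K], embedded as [1%VS]. *)
    have /vlineP[c ->] : x \in 1%VS.
      have /galois_fixedField <- := galLK.
      by apply/fixedFieldP; rewrite ?memvf // => g _; apply: fixx.
    by exists c.
  by have := fP g P SP; rewrite (fixP g (galT g)).
apply: rank_jump => [P|m indK maxK indL]; first exact: KS.
(* Rank exactly [m + 1] over [L] would produce the excluded subgroup of index 2. *)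
apply: NNPP => maxL; apply: no_index2.
apply: (index2_subgroup S0 SD SN fS fD f1 fM indL maxL (m := m)).
  by apply: has_indep_sub indK => P /fixedE.
by move=> ind; apply: maxK; apply: has_indep_sub ind => P /fixedE.
Qed.
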